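(* Consider an arbitrary 2-colex with vertex set $\mathcal{V}$ and $F$ faces, real couplings $\{J_a\}_{a\in\mathcal{V}}$ and inverse temperature $\beta$. Let $|\Omega\rangle$ be the associated topological color code state, let $\mathcal{Z}$ be the partition function of the associated 3-body Ising model, and let $A=\bigotimes_{a\in\mathcal{V}}A_a$ with $$A_a=\frac{1}{\sqrt{e^{2\beta J_a}+e^{-2\beta J_a}}}\begin{pmatrix}e^{\beta J_a}&e^{-\beta J_a}\\ e^{-\beta J_a}&-e^{\beta J_a}\end{pmatrix}.$$ Then $$\mathcal{Z}=\frac{\gamma}{\sqrt{2^{F-2}}}\cdot\langle\Omega|A|\Omega\rangle,\qquad \gamma=\sqrt{2^{F+2}}\prod_{a\in\mathcal{V}}\sqrt{e^{2\beta J_a}+e^{-2\beta J_a}}.$$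
   Context: A 2-colex is a finite connected graph embedded cellularly (all faces are discs) in a closed orientable surface of arbitrary genus $g\ge 0$ such that every vertex has degree 3 and the faces are 3-colorable (each face can be given one of three colors so that faces sharing an edge have different colors). $\mathcal{V}$ and $\mathcal{F}$ are its vertex and face sets, $V=|\mathcal{V}|$, $F=|\mathcal{F}|$. Each vertex $a$ is adjacent to exactly three faces, denoted $\mathfrak{f}_a,\mathfrak{g}_a,\mathfrak{h}_a$. The associated 3-body Ising model: a spin $\sigma_{\mathfrak{f}}\in\{1,-1\}$ is placed on each face; for real couplings $J_a$ the energy of a configuration $\sigma$ is $H(\sigma)=-\sum_{a\in\mathcal{V}}J_a\,\sigma_{\mathfrak{f}_a}\sigma_{\mathfrak{g}_a}\sigma_{\mathfrak{h}_a}$. With real inverse temperature $\beta\ge 0$, $\mathcal{Z}=\sum_{\sigma}e^{-\beta H(\sigma)}$, summed over all $2^F$ configurations. Place a qubit on each vertex, giving the Hilbert space $(\mathbb{C}^2)^{\otimes V}$. With $X$ the Pauli matrix, put $X_{\mathfrak{f}}=\bigotimes_{v\in\mathfrak{f}}X_v$ for each face (acting as identity on other qubits). The color code state is $|\Omega\rangle=N^{-1}\prod_{\mathfrak{f}\in\mathcal{F}}(I+X_{\mathfrak{f}})|0\rangle$, where $|0\rangle$ is the all-zeros basis state and $N>0$ is such that $|\Omega\rangle$ has norm 1. *)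

(* Defs.v *)
From HB Require Import structures.
From mathcomp Require Import all_boot all_order all_algebra all_fingroup.
From mathcomp Require Import spectral complex.
From mathcomp Require Import reals sequences exp.

Set Implicit Arguments.
Unset Strict Implicit.
Unset Printing Implicit Defensive.

Import Order.TTheory GRing.Theory Num.Theory.

Local Open Scope ring_scope.
Local Open Scope complex_scope.
Local Open Scope sesquilinear_scope.

(* A cellular embedding of a graph (loops and multiple edges are not excluded
   a priori) in a closed oriented surface, given by its rotation system: darts
   are oriented edges, [rot] sends a dart to the next one around its tail
   vertex, and [opp] reverses a dart. *)
Record embedded_graph := EmbeddedGraph {
  dart : finType;
  rot : {perm dart};
  opp : {perm dart};
  opp_involutive : involutive opp;
  opp_neq : forall x, opp x != x
}.

(* The next dart along the boundary of the face lying on a fixed side of [x]: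
   cross the edge, then rotate by one step at the other end. *)
Definition face_perm (G : embedded_graph) : {perm dart G} := (opp G * rot G)%g.

Definition vertex (G : embedded_graph) : finType :=
  {a : {set dart G} | a \in porbits (rot G)}.

Definition face (G : embedded_graph) : finType :=
  {f : {set dart G} | f \in porbits (face_perm G)}.

(* A dart stands both for an oriented edge leaving its tail and for one corner
   at that tail, so a vertex lies on a face iff they have a dart in common. *)
Definition incident (G : embedded_graph) (a : vertex G) (f : face G) : bool :=
  [exists x, (x \in val a) && (x \in val f)].

Definition adjacent (G : embedded_graph) : rel (vertex G) :=
  fun a b => [exists x, (x \in val a) && (opp G x \in val b)].

(* The faces on the two sides of an edge are those of its two darts. *)
Definition share_edge (G : embedded_graph) : rel (face G) :=
  fun f g => [exists x, (x \in val f) && (opp G x \in val g)].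

Definition is_connected (G : embedded_graph) : Prop :=
  (0 < #|vertex G|)%N /\ forall a b : vertex G, connect (@adjacent G) a b.

Definition is_cubic (G : embedded_graph) : Prop :=
  forall a : vertex G, #|val a| = 3.

Definition faces_3colorable (G : embedded_graph) : Prop :=
  exists c : face G -> 'I_3, forall f g, share_edge f g -> c f != c g.

Definition is_2colex (G : embedded_graph) : Prop :=
  [/\ is_connected G, is_cubic G & faces_3colorable G].

Lemma card_incident_faces (G : embedded_graph) (a : vertex G) :
  is_2colex G -> #|[set f | incident a f]| = 3.
Proof.
case=> _ cubic [c hc].
have inF x : porbit (face_perm G) x \in porbits (face_perm G) by exact: imset_f.
pose F (x : dart G) : face G := exist _ (porbit (face_perm G) x) (inF x).
have FE x (f : face G) : x \in val f -> f = F x.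
  case: f => A /= hA xA; apply: val_inj => /=.
  by case/imsetP: hA xA => y _ ->; rewrite -eq_porbit_mem => /eqP.
have hF x : c (F x) != c (F (rot G x)).
  have -> : F (rot G x) = F (opp G x).
    apply: val_inj; apply/eqP; rewrite /= eq_porbit_mem.
    by rewrite -{1}(opp_involutive x) -permM; apply: (mem_porbit (face_perm G) 1).
  by apply: hc; apply/existsP; exists x; rewrite !porbit_id.
case/imsetP: (valP a) => x _ Ea.
have c3 : #|porbit (rot G) x| = 3 by rewrite -Ea; exact: cubic.
pose y := rot G x; pose z := rot G y.
have zx : rot G z = x by have := iter_porbit (rot G) x; rewrite c3.
have memE w : (w \in val a) = [|| w == x, w == y | w == z].
  by rewrite Ea porbit_traject c3 /= !inE.
have -> : [set f | incident a f] = [set F x; F y; F z].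
  apply/setP=> f; rewrite !inE -orbA; apply/existsP/idP.
    case=> w /andP[]; rewrite memE => /or3P[]/eqP-> /FE ->;
    by rewrite eqxx ?orbT.
  by case/or3P=> /eqP->; [exists x | exists y | exists z];
    rewrite memE eqxx ?orbT porbit_id.
have neF u v : c (F u) != c (F v) -> F u != F v by apply: contraNneq => ->.
have nxy := neF _ _ (hF x); have nyz := neF _ _ (hF y).
have nzx := neF _ _ (hF z); rewrite zx in nzx.
by rewrite -setUA cardsU1 cards2 !inE negb_or nxy nyz eq_sym nzx.
Qed.

Section Ising.
Variables (R : realType) (G : embedded_graph).

Definition spin_config : finType := {ffun face G -> bool}.

Definition spin (sigma : spin_config) (f : face G) : R := (-1) ^+ sigma f.

(* In a 2-colex the product over faces has exactly three factors, see
   [card_incident_faces]. *)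
Definition energy (J : vertex G -> R) (sigma : spin_config) : R :=
  - \sum_a J a * \prod_(f | incident a f) spin sigma f.

Definition partition_function (beta : R) (J : vertex G -> R) : R :=
  \sum_(sigma : spin_config) expR (- beta * energy J sigma).

End Ising.

Definition mx2 (T : Type) (a b c d : T) : 'M[T]_2 :=
  \matrix_(i, j) if i == 0 then (if j == 0 then a else b)
                 else (if j == 0 then c else d).

Section Qubits.
Variables (R : realType) (V : finType).

(* The computational basis of the space of qubits indexed by [V]; vectors and
   operators are matrices over R[i] whose indices enumerate this basis. *)
Definition basis : finType := {ffun V -> 'I_2}.

Definition state := 'cV[R[i]]_#|basis|.
Definition operator := 'M[R[i]]_#|basis|.

Definition bits (i : 'I_#|basis|) : {ffun V -> 'I_2} := enum_val i.

Definition tensor (A : V -> 'M[R[i]]_2) : operator :=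
  \matrix_(i, j) \prod_v A v (bits i v) (bits j v).

Definition ket0 : state :=
  \col_i (bits i == [ffun=> 0])%:R.

Definition bra_ket (u v : state) : R[i] := (u ^t* *m v) 0 0.

Definition norm (u : state) : R[i] := sqrtC (bra_ket u u).

End Qubits.

Section ColorCode.
Variables (R : realType) (G : embedded_graph).

Definition pauliX : 'M[R[i]]_2 := mx2 0 1 1 0.

Definition face_X (f : face G) : operator R (vertex G) :=
  tensor (fun a => if incident a f then pauliX else 1%:M).

Definition unnormalized_color_code : state R (vertex G) :=
  (\prod_(f : face G) (1%:M + face_X f)) *m ket0 R (vertex G).

Definition color_code_state : state R (vertex G) :=
  (norm unnormalized_color_code)^-1 *: unnormalized_color_code.

Lemma norm_color_code_state : norm color_code_state = 1.
Proof.
have Xge0 f i j : 0 <= face_X f i j.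
  rewrite mxE; apply: prodr_ge0 => v _.
  by case: ifP => _; rewrite !mxE; repeat case: ifP => _; rewrite ?ler0n ?ler01.
pose P (M : operator R (vertex G)) := forall i j, (i == j)%:R <= M i j.
have hP : P (\prod_(f : face G) (1%:M + face_X f)).
  elim/big_ind: _ => [i j|A B hA hB i j|f _ i j].
  - by rewrite mxE.
  - have A0 k l : 0 <= A k l by apply: le_trans (hA k l); rewrite ler0n.
    have B0 k l : 0 <= B k l by apply: le_trans (hB k l); rewrite ler0n.
    rewrite mxE (bigD1 i) //=; apply: le_trans (_ : A i i * B i j <= _).
      have := hA i i; rewrite eqxx => hAi.
      by apply: le_trans (hB i j) _; rewrite ler_peMl.
    by rewrite lerDl sumr_ge0 // => k _; rewrite mulr_ge0.
  - by rewrite !mxE lerDl; have := Xge0 f i j; rewrite mxE.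
pose i0 := enum_rank ([ffun=> 0] : basis (vertex G)).
have psi1 : 1 <= unnormalized_color_code i0 0.
  rewrite mxE (bigD1 i0) //= [X in _ + X]big1 => [|k ki]; last first.
    rewrite /ket0 mxE [_ == _](_ : _ = false) ?mulr0 //.
    by apply: contraNF ki => /eqP E; rewrite /i0 -E /bits enum_valK.
  by rewrite mxE /bits enum_rankK eqxx mulr1 addr0; have := hP i0 i0; rewrite eqxx.
set psi := unnormalized_color_code in psi1 *.
have bk (u : state R (vertex G)) : bra_ket u u = \sum_i `|u i 0| ^+ 2.
  by rewrite /bra_ket mxE; apply: eq_bigr => i _; rewrite !mxE normCKC.
have pos : 0 < bra_ket psi psi.
  rewrite bk (bigD1 i0) //=; apply: ltr_pwDl.
    by rewrite exprn_gt0 // normr_gt0 gt_eqF // (lt_le_trans ltr01).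
  by apply: sumr_ge0 => i _; rewrite exprn_ge0.
have npos : 0 < norm psi by rewrite /norm sqrtC_gt0.
rewrite /norm [bra_ket _ _](_ : _ = 1) ?sqrtC1 //.
rewrite bk; under eq_bigr do rewrite mxE normrM exprMn.
rewrite -mulr_sumr -bk ger0_norm ?invr_ge0 ?ltW //.
by rewrite exprVn /norm sqrtCK mulVf // gt_eqF.
Qed.

Definition vertex_op (beta Ja : R) : 'M[R[i]]_2 :=
  (1 / Num.sqrt (expR (2 * beta * Ja) + expR (- 2 * beta * Ja)))%:C *:
  mx2 (expR (beta * Ja))%:C (expR (- beta * Ja))%:C
      (expR (- beta * Ja))%:C (- expR (beta * Ja))%:C.

Definition gamma (beta : R) (J : vertex G -> R) : R :=
  Num.sqrt (2 ^+ (#|face G| + 2)) *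
  \prod_a Num.sqrt (expR (2 * beta * J a) + expR (- 2 * beta * J a)).

End ColorCode.

(* Main.v *)
Require Import Defs.
From mathcomp Require Import all_boot all_order all_algebra all_fingroup.
From mathcomp Require Import spectral complex.
From mathcomp Require Import ring.
From mathcomp Require Import reals sequences exp.

(* Expanding the product, |Omega> is proportional to the sum of |phi s> over
   face subsets s, where phi s records, at each vertex, the parity of the
   number of its faces in s. The entry of the product of the A_a between
   |phi s> and |phi t> is, up to normalisation, the Boltzmann weight of s +
   t times the sign (-1)^(phi s . phi t). The sign is 1: phi s . phi t is
   the sum over the corners x of s at x times t at the three corners of the
   vertex of x; modulo 2 the two corners other than x cancel out, since
   either gives the sum over the oriented edges of s on one side times t on
   the other, and x itself contributes 0 because every face has even
   length. Hence <Omega|A|Omega> is Z up to a factor involving |ker phi|.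
   This kernel has 4 elements: in it, s is constant on each colour class
   (the faces at the two ends of an edge agree colour by colour, and the
   graph is connected), the three constants having sum 0 modulo 2. *)

Import Order.TTheory GRing.Theory Num.Theory.
Local Open Scope ring_scope.
Local Open Scope complex_scope.

(* The names of [Defs] are shadowed by the imports above. *)
Local Notation rot := Defs.rot.
Local Notation opp := Defs.opp.

(** * Corners, vertices and faces of the embedded graph *)

Section Darts.
Variable G : embedded_graph.
Implicit Types (x y : dart G) (a b : vertex G) (f g : face G).

Definition vertex_of x : vertex G :=
  exist _ (porbit (rot G) x) (imset_f _ (erefl true : x \in dart G)).

Definition face_of x : face G :=
  exist _ (porbit (face_perm G) x) (imset_f _ (erefl true : x \in dart G)).

Lemma mem_vertex x a : (x \in val a) = (vertex_of x == a).
Proof.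
apply/idP/eqP => [|<-]; last exact: porbit_id.
case: a => A /= hA xA; apply: val_inj => /=.
by case/imsetP: hA xA => y _ ->; rewrite -eq_porbit_mem => /eqP.
Qed.

Lemma mem_face x f : (x \in val f) = (face_of x == f).
Proof.
apply/idP/eqP => [|<-]; last exact: porbit_id.
case: f => A /= hA xA; apply: val_inj => /=.
by case/imsetP: hA xA => y _ ->; rewrite -eq_porbit_mem => /eqP.
Qed.

Lemma vertex_ofP a : exists x, vertex_of x = a.
Proof.
by case: a => A hA; have /imsetP[x _ E] := hA; exists x; apply: val_inj.
Qed.

Lemma face_ofP f : exists x, face_of x = f.
Proof.
by case: f => A hA; have /imsetP[x _ E] := hA; exists x; apply: val_inj.
Qed.

Lemma vertex_of_rot x : vertex_of (rot G x) = vertex_of x.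
Proof.
by apply/eqP; rewrite -mem_vertex; apply: (mem_porbit (rot G) 1).
Qed.

Lemma face_of_step x : face_of (rot G (opp G x)) = face_of x.
Proof.
apply/eqP; rewrite -mem_face -permM; exact: (mem_porbit (face_perm G) 1).
Qed.

Lemma face_of_opp x : face_of (opp G x) = face_of (rot G x).
Proof. by rewrite -{2}[x](@opp_involutive G) face_of_step. Qed.

(* [bool] carries its field structure: the sum is an exclusive or. *)
Definition parity (s : {ffun face G -> bool}) : {ffun vertex G -> bool} :=
  [ffun a => \sum_(f | incident a f) s f].

Lemma parityD s t : parity (s + t) = parity s + parity t.
Proof.
apply/ffunP=> a; rewrite !ffunE -big_split /=.
by apply: eq_bigr => f _; rewrite ffunE.
Qed.

End Darts.

Arguments vertex_of {G}.
Arguments face_of {G}.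
Arguments parity {G}.

(** * Colours around a vertex; orthogonality and kernel of [parity] *)

Lemma ord3_third (i j k l : 'I_3) :
  i != j -> j != k -> k != i -> [\/ l = i, l = j | l = k].
Proof.
move=> ij jk ki; have: l \in [set i; j; k].
  suff -> : [set i; j; k] = setT by [].
  apply/eqP; rewrite eqEcard subsetT cardsT card_ord -setUA cardsU1 cards2.
  by rewrite !inE negb_or ij jk eq_sym ki.
rewrite !inE -orbA => /or3P[] /eqP ?;
  by [apply: Or31 | apply: Or32 | apply: Or33].
Qed.

Lemma ord3_succ (i j k : 'I_3) :
  i != j -> j != k -> k != i -> (k == i + 1) = ~~ (j == i + 1).
Proof.
move=> ij jk ki; have i1 : i + 1 != i.
  by rewrite -subr_eq0 addrC addKr oner_eq0.
case: (ord3_third _ _ _ (i + 1) ij jk ki) => E; first by rewrite E eqxx in i1.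
  by rewrite E eqxx eq_sym (negbTE jk).
by rewrite E eqxx jk.
Qed.

Section Colex.
Variables (G : embedded_graph) (c : face G -> 'I_3).
Hypothesis connG : is_connected G.
Hypothesis cubicG : is_cubic G.
Hypothesis properc : forall f g, share_edge f g -> c f != c g.
Implicit Types (x y : dart G) (a b : vertex G) (f g : face G).
Implicit Types s t : {ffun face G -> bool}.

Let color x := c (face_of x).
Let r := rot G.

Lemma rot3 x : r (r (r x)) = x.
Proof.
have := iter_porbit r x.
by have := cubicG (vertex_of x); rewrite /= => ->.
Qed.

Lemma color_rot x : color x != color (r x).
Proof.
rewrite /color -face_of_opp; apply: properc; apply/existsP; exists x.
by rewrite !mem_face !eqxx.
Qed.

Lemma color_rot2 x : color (r (r x)) != color x.
Proof. by rewrite -{2}[x]rot3 color_rot. Qed.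

Lemma vertex_darts x y :
  (vertex_of y == vertex_of x) = [|| y == x, y == r x | y == r (r x)].
Proof.
rewrite -mem_vertex /= porbit_traject.
by have := cubicG (vertex_of x); rewrite /= => ->; rewrite !inE.
Qed.

Lemma sum_vertex (T : nmodType) (h : dart G -> T) x :
  \sum_(y | vertex_of y == vertex_of x) h y = h x + h (r x) + h (r (r x)).
Proof.
have nx y : y != r y by apply: contraNneq (color_rot y) => <-.
have nx2 : r (r x) != x by apply: contraNneq (color_rot2 x) => ->.
rewrite (bigD1 x) //= (bigD1 (r x)) /=; last first.
  by rewrite vertex_of_rot eqxx eq_sym nx.
rewrite (bigD1 (r (r x))) /=; last by rewrite !vertex_of_rot eqxx nx2 eq_sym nx.
rewrite big_pred0 ?addr0 ?addrA // => y; rewrite vertex_darts.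
by do 3!case: (_ == _).
Qed.

(** The corners of a vertex have distinct colours, hence lie on distinct faces, so incident faces
    can be counted by corners. *)
Lemma parityE s a : parity s a = \sum_(x | vertex_of x == a) s (face_of x).
Proof.
have inj : {in val a &, injective face_of}.
  move=> x y; rewrite !mem_vertex => /eqP <-; rewrite vertex_darts.
  have ne u v : color u != color v -> face_of u = face_of v -> u = v.
    by move=> h E; rewrite /color E eqxx in h.
  case/or3P=> /eqP -> //; apply: ne; first exact: color_rot.
  by rewrite eq_sym color_rot2.
rewrite ffunE; under [RHS]eq_bigl do rewrite -mem_vertex.
rewrite -(big_imset s inj) /=; apply: eq_bigl => f.
apply/existsP/imsetP => [[x /andP[xa]]|[x xa ->]].
  by rewrite mem_face => /eqP <-; exists x.
by exists x; rewrite xa mem_face eqxx.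
Qed.

Lemma parity_at s x : parity s (vertex_of x) =
  s (face_of x) + s (face_of (r x)) + s (face_of (r (r x))).
Proof. by rewrite parityE (sum_vertex _ (fun y => s (face_of y))). Qed.

(** Tells whether the colours increase cyclically around the vertex of [x], which yields the
    bipartition of the graph. *)
Let positive x := color (r x) == color x + 1.

(** The two faces beside an edge occur in opposite rotational orders at its two ends. *)
Lemma positive_step x : positive (r (opp G x)) = ~~ positive x.
Proof.
have o1 := face_of_opp _ x; have o2 := face_of_step _ x.
rewrite /positive /color -/r o2; apply: ord3_succ.
- by rewrite -/(color x) color_rot.
- by rewrite -o1 -/(color (opp G x)) eq_sym color_rot2.
- by rewrite -o2 -/(color (r (opp G x))) eq_sym color_rot.
Qed.

(* The corners of a face alternate between [positive] and not, so its length is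
   even. *)
Lemma sum_dart_face s : \sum_x s (face_of x) = 0.
Proof.
rewrite (bigID positive) /=.
rewrite (reindex_inj (h := face_perm G)) /=; last exact: perm_inj.
under eq_bigl do rewrite permM positive_step.
by under eq_bigr do rewrite permM face_of_step; exact: addbb.
Qed.

Lemma parity_orthogonal s t : \sum_a parity s a * parity t a = 0.
Proof.
have E a : parity s a * parity t a = \sum_(x | vertex_of x == a)
    (s (face_of x) * t (face_of x) + s (face_of x) * t (face_of (r x)) +
     s (face_of x) * t (face_of (r (r x)))).
  rewrite parityE mulr_suml; apply: eq_bigr => x /eqP <-.
  by rewrite parity_at !mulrDr.
rewrite (eq_bigr _ (fun a _ => E a)).
rewrite -(@partition_big _ _ _ _ _ _ xpredT (@vertex_of G) xpredT) //=.
rewrite !big_split /=.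
(* The pointwise product of [s] and [t] is again a face function, so the even length of faces
   applies to it. *)
have -> : \sum_x s (face_of x) * t (face_of x) = 0.
  rewrite -[RHS](sum_dart_face [ffun f => s f * t f]).
  by apply: eq_bigr => x _; rewrite ffunE.
rewrite add0r.
(* Substituting [r x] for [x] leaves the corners [r x] and [x], on the two sides of one edge;
   reversing the edge swaps the sides. Two equal sums cancel modulo 2. *)
have -> : \sum_x s (face_of x) * t (face_of (r (r x))) =
          \sum_x s (face_of x) * t (face_of (r x)); last exact: addbb.
rewrite (reindex_inj (h := r)) /=; last exact: perm_inj.
under eq_bigr do rewrite rot3.
rewrite (reindex_inj (h := opp G)) /=; last exact: perm_inj.
by apply: eq_bigr => x _; rewrite face_of_step face_of_opp.
Qed.

Lemma card_parity_kernel :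
  #|[set s : {ffun face G -> bool} | parity s == 0]| = 4.
Proof.
have [/card_gt0P[a0 _] conn] := connG; have [x0 Ex0] := vertex_ofP _ a0.
(* Two colours carry free bits; the third carries their sum, so that the three add up to 0. *)
pose w (pq : bool * bool) (k : 'I_3) : bool :=
  if k == color x0 then pq.1 else if k == color (r x0) then pq.2
  else pq.1 + pq.2.
pose s_ pq : {ffun face G -> bool} := [ffun f => w pq (c f)].
have r10 : (color (r x0) == color x0) = false.
  by apply/negbTE; rewrite eq_sym color_rot.
have r20 : (color (r (r x0)) == color x0) = false by apply/negbTE/color_rot2.
have r21 : (color (r (r x0)) == color (r x0)) = false.
  by apply/negbTE; rewrite eq_sym color_rot.
have w0 pq x : w pq (color x) + w pq (color (r x)) + w pq (color (r (r x))) = 0.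
  have n1 := color_rot x; have n2 := color_rot (r x); have n3 := color_rot2 x.
  have third := ord3_third _ _ _ _ n1 n2 n3.
  have third0 := ord3_third _ _ _ _
    (color_rot x0) (color_rot (r x0)) (color_rot2 x0).
  rewrite /w; move: n1 n2 n3.
  by case: (third0 (color x)) => ->; case: (third0 (color (r x))) => ->;
    case: (third0 (color (r (r x)))) => ->;
    rewrite ?eqxx ?r10 ?r20 ?r21 //; case: pq => [[] []].
have s_inj : injective s_.
  move=> [p q] [p' q'] /ffunP E.
  have := E (face_of (r x0)); have := E (face_of x0); rewrite !ffunE /w /=.
  by rewrite -!/(color _) !eqxx r10 => -> ->.
rewrite -[RHS](_ : #|s_ @: [set: bool * bool]| = 4); last first.
  by rewrite card_imset // cardsT card_prod card_bool.
congr #|pred_of_set _|; apply/setP => s; rewrite inE.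
apply/eqP/imsetP => [ker_s | [pq _ ->]]; last first.
  apply/ffunP=> a; have [x <-] := vertex_ofP _ a.
  by rewrite parity_at !ffunE; apply: w0.
have ker x : s (face_of x) + s (face_of (r x)) + s (face_of (r (r x))) = 0.
  by rewrite -parity_at ker_s ffunE.
pose pq := (s (face_of x0), s (face_of (r x0))); exists pq => //.
pose Q a := forall x, vertex_of x = a -> s (face_of x) = w pq (color x).
(* The kernel equation at a vertex determines the third corner from the other two. *)
have Qrot x : s (face_of x) = w pq (color x) ->
    s (face_of (r x)) = w pq (color (r x)) -> Q (vertex_of x).
  move=> h1 h2 y /eqP; rewrite vertex_darts => /or3P[]/eqP-> //.
  have := ker x; rewrite -(w0 pq x) h1 h2; exact: addrI.
have Qa0 : Q a0.
  by rewrite -Ex0; apply: Qrot; rewrite /w ?r10 eqxx.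
(* Past an edge, the corners [opp G x] and [r (opp G x)] lie on the faces of [r x] and [x], already
   settled; [Qrot] gives the third corner. *)
have Qall a : Q a.
  case/connectP: (conn a0 a) => p; elim: p (a0) Qa0 => [|b' p IH] b Qb /=.
    by move=> _ ->.
  case/andP=> /existsP[x]; rewrite !mem_vertex => /andP[/eqP xb /eqP xb'].
  move=> pth; apply: IH pth; rewrite -xb' -vertex_of_rot -/r.
  move=> y; rewrite vertex_of_rot; apply: Qrot; rewrite /color.
    by rewrite face_of_opp; apply: Qb; rewrite vertex_of_rot.
  by rewrite face_of_step; apply: Qb.
apply/ffunP=> f; have [x <-] := face_ofP _ f; rewrite ffunE.
exact: (Qall (vertex_of x)).
Qed.

End Colex.

(** * Operators on basis vectors and expansion of the code state *)

Lemma prod_1D (T : pzSemiRingType) (I : finType) (x : I -> T) :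
  \prod_i (1 + x i) =
  \sum_(s : {ffun I -> bool}) \prod_i (if s i then x i else 1).
Proof.
rewrite -(bigA_distr_bigA (fun i (b : bool) => if b then x i else 1)).
by apply: eq_bigr => i _; rewrite big_bool addrC.
Qed.

Section Kets.
Variables (R : realType) (V : finType).
Implicit Types (u v : {ffun V -> bool}) (A : V -> 'M[R[i]]_2).

Definition basis_index u : 'I_#|basis V| :=
  enum_rank ([ffun a => if u a then 1 else 0] : basis V).

Definition ket u : state R V := delta_mx (basis_index u) 0.

Lemma basis_index_inj : injective basis_index.
Proof.
move=> u v /enum_rank_inj/ffunP E; apply/ffunP => a.
by have := E a; rewrite !ffunE; case: (u a); case: (v a).
Qed.

Lemma ket0E : ket0 R V = ket 0.
Proof.
apply/colP => i; rewrite !mxE eqxx andbT; congr (_ %:R).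
rewrite -(can_eq enum_valK) /basis_index enum_rankK.
by congr (nat_of_bool (_ == _)); apply/ffunP => a; rewrite !ffunE.
Qed.

Lemma tensor_index A u v :
  tensor A (basis_index u) (basis_index v) =
  \prod_a A a (if u a then 1 else 0) (if v a then 1 else 0).
Proof.
by rewrite mxE /bits !enum_rankK; apply: eq_bigr => a _; rewrite !ffunE.
Qed.

Lemma bra_ket_sum (I : finType) (w : I -> {ffun V -> bool}) (M : operator R V) :
  bra_ket (\sum_s ket (w s)) (M *m \sum_s ket (w s)) =
  \sum_s \sum_t M (basis_index (w s)) (basis_index (w t)).
Proof.
rewrite /bra_ket (raddf_sum trmx) /= map_mx_sum mulmx_suml summxE.
apply: eq_bigr => s _.
rewrite !mulmx_sumr summxE; apply: eq_bigr => t _.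
by rewrite trmx_delta map_delta_mx -colE -rowE !mxE.
Qed.

(** Each factor's entry tests whether the row bit is the column bit plus [p a]; the product of these
    tests is equality of bit strings. *)
Lemma tensor_flip_ket (p : pred V) v :
  tensor (fun a => if p a then pauliX R else 1%:M) *m ket v =
  ket (v + [ffun a => p a]).
Proof.
rewrite -colE; apply/colP => i; rewrite !mxE eqxx andbT /bits.
rewrite -(can_eq enum_valK) /basis_index !enum_rankK.
rewrite -[RHS](_ : \prod_a
    (enum_val i a == (if v a + p a then 1 else 0 : 'I_2))%:R = _ :> R[i]).
  apply: eq_bigr => a _; rewrite !ffunE.
  have : enum_val i a = 0 \/ enum_val i a = 1.
    by case: (enum_val i a) => [[|[|//]]] ?; [left | right]; apply: val_inj.
  by case=> ->; case: (p a); case: (v a); rewrite !mxE.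
have [E|/eqP nE] := eqVneq.
  by apply: big1 => a _; rewrite E !ffunE eqxx.
have /existsP[a ha] : [exists a, enum_val i a !=
    (if v a + p a then 1 else 0 : 'I_2)].
  rewrite -negb_forall; apply/negP => /forallP h; apply: nE; apply/ffunP => a.
  by rewrite (eqP (h a)) !ffunE.
by rewrite (bigD1 a) //= (negbTE ha) mul0r.
Qed.

End Kets.

Arguments ket R {V}.
Arguments basis_index {V}.

Lemma unnormalized_color_codeE (R : realType) (G : embedded_graph) :
  unnormalized_color_code R G =
  \sum_(s : {ffun face G -> bool}) ket R (parity s).
Proof.
rewrite /unnormalized_color_code ket0E.
rewrite prod_1D mulmx_suml; apply: eq_bigr => s _.
have -> : parity s = 0 + \sum_f [ffun a => s f && incident a f].
  rewrite add0r; apply/ffunP => a; rewrite sum_ffunE ffunE big_mkcond /=.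
  by apply: eq_bigr => f _; rewrite ffunE andbC; case: incident.
(* [K M w]: the operator [M] translates labels by [w]. Composing operators adds translations, so the
   relation passes to the whole product. *)
pose K (M : operator R (vertex G)) (w : {ffun vertex G -> bool}) :=
  forall v, M *m ket R v = ket R (v + w).
suff: K (\prod_f (if s f then face_X R f else 1))
  (\sum_f [ffun a => s f && incident a f]) by apply.
apply: (@big_ind2 _ _ K) => [v|M1 w1 M2 w2 h1 h2 v|f _ v].
- by rewrite mul1mx addr0.
- by rewrite -mulmxA h2 h1 -addrA [w1 + w2]addrC.
case: (s f); first by rewrite /face_X tensor_flip_ket.
rewrite mul1mx; congr ket.
by rewrite [X in _ + X](_ : _ = 0) ?addr0 //; apply/ffunP => a; rewrite !ffunE.
Qed.

(** By additivity of [parity], and since [s + t] runs over all configurations with [t], every [s]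
    contributes the same inner sum. *)
Lemma sum_parityD (G : embedded_graph) (T : nmodType)
    (h : {ffun vertex G -> bool} -> T) :
  \sum_(s : {ffun face G -> bool}) \sum_(t : {ffun face G -> bool})
    h (parity s + parity t) =
  (\sum_(s : {ffun face G -> bool}) h (parity s)) *+ 2 ^ #|face G|.
Proof.
rewrite -[in RHS]card_bool -card_ffun -sumr_const.
apply: eq_bigr => s _; rewrite [RHS](reindex_inj (addrI s)).
by apply: eq_bigr => t _; rewrite parityD.
Qed.

Lemma signr_sum (R : pzRingType) (I : finType) (P : pred I) (b : I -> bool) :
  (-1) ^+ ((\sum_(i | P i) b i)%R : bool) =
  \prod_(i | P i) (-1) ^+ b i :> R.
Proof. exact: (big_morph (fun c : bool => (-1) ^+ c) (@signr_addb R)). Qed.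

(** * Boltzmann weights and entries of the product operator *)

Section Expectation.
Variables (R : realType) (G : embedded_graph) (beta : R) (J : vertex G -> R).

Let z a := Num.sqrt (expR (2 * beta * J a) + expR (- 2 * beta * J a)).

(** The Boltzmann factor of a configuration of parity [u]: the bit [u a] records the sign of the
    spin product at [a]. *)
Definition weight (u : {ffun vertex G -> bool}) : R :=
  \prod_a expR (beta * J a * (-1) ^+ u a).

Lemma partition_functionE :
  partition_function beta J =
  \sum_(s : {ffun face G -> bool}) weight (parity s).
Proof.
apply: eq_bigr => s _; rewrite /energy mulrNN mulr_sumr expR_sum.
apply: eq_bigr => a _; rewrite mulrA; congr (expR (_ * _)).
by rewrite ffunE signr_sum.
Qed.

(** The only negative entry is at [p = q = 1], and the exponent changes sign exactly off the
    diagonal. *)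
Lemma vertex_opE (Ja : R) (p q : bool) :
  vertex_op beta Ja (if p then 1 else 0) (if q then 1 else 0) =
  ((Num.sqrt (expR (2 * beta * Ja) + expR (- 2 * beta * Ja)))^-1 *
   ((-1) ^+ (p * q)%R * expR (beta * Ja * (-1) ^+ (p + q)%R)))%:C.
Proof.
rewrite !mxE div1r rmorphM; congr (_ * _).
by case: p; case: q; rewrite /= ?expr0 ?expr1 ?mulr1 ?mul1r ?mulN1r
  ?mulrN1 ?mulNr ?rmorphN.
Qed.

Lemma tensor_vertex_op u v :
  tensor (fun a => vertex_op beta (J a)) (basis_index u) (basis_index v) =
  ((\prod_a z a)^-1 * ((-1) ^+ (\sum_a u a * v a)%R * weight (u + v)))%:C.
Proof.
rewrite tensor_index signr_sum -prodfV -!big_split /= rmorph_prod.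
by apply: eq_bigr => a _; rewrite vertex_opE ffunE.
Qed.

End Expectation.

(** * Norm, expectation value and the final identity *)

Section Overlaps.
Variables (R : realType) (G : embedded_graph).
Hypothesis colexG : is_2colex G.

(** A pair [s], [t] contributes 1 exactly when [s + t] lies in the kernel of [parity], which has
    four elements. *)
Lemma bra_ket_unnormalized :
  bra_ket (unnormalized_color_code R G) (unnormalized_color_code R G) =
  (4 * 2 ^ #|face G|)%:R.
Proof.
have [conn cubic [c hc]] := colexG.
rewrite unnormalized_color_codeE -[X in bra_ket _ X]mul1mx bra_ket_sum.
have E (s t : {ffun face G -> bool}) :
    (1%:M : operator R _) (basis_index (parity s)) (basis_index (parity t)) =
    (parity s + parity t == 0)%:R.
  rewrite mxE (inj_eq (@basis_index_inj _)) addr_eq0.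
  by have -> : - parity t = parity t by apply/ffunP => a; rewrite ffunE.
under eq_bigr do under eq_bigr do rewrite E.
rewrite (sum_parityD _ _ (fun u => (u == 0)%:R)) -natr_sum -big_mkcond.
rewrite sum1_card.
by rewrite -cardsE (card_parity_kernel _ c) // natrM mulr_natr.
Qed.

Lemma bra_ket_tensor_unnormalized (beta : R) (J : vertex G -> R) :
  bra_ket (unnormalized_color_code R G)
    (tensor (fun a => vertex_op beta (J a)) *m unnormalized_color_code R G) =
  ((\prod_a Num.sqrt (expR (2 * beta * J a) + expR (- 2 * beta * J a)))^-1 *
   (partition_function beta J *+ 2 ^ #|face G|))%:C.
Proof.
have [_ cubic [c hc]] := colexG.
rewrite unnormalized_color_codeE bra_ket_sum partition_functionE -sum_parityD.
rewrite mulr_sumr rmorph_sum; apply: eq_bigr => s _.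
rewrite mulr_sumr rmorph_sum; apply: eq_bigr => t _.
by rewrite tensor_vertex_op (parity_orthogonal _ c) // mul1r.
Qed.

End Overlaps.

Theorem theorem2 (R : realType) (G : embedded_graph) (hG : is_2colex G)
    (J : vertex G -> R) (beta : R) (hbeta : 0 <= beta) :
  (partition_function beta J)%:C =
  (gamma beta J / Num.sqrt (2 ^ (#|face G|%:Z - 2)))%:C *
  bra_ket (color_code_state R G)
    (tensor (fun a => vertex_op beta (J a)) *m color_code_state R G).
Proof.
set n := norm (unnormalized_color_code R G).
have n2 : n^-1 ^* * n^-1 = ((4 * 2 ^ #|face G|)%:R)^-1.
  have n0 : 0 <= n by rewrite sqrtC_ge0 bra_ket_unnormalized // ler0n.
  rewrite -normCKC ger0_norm ?invr_ge0 // exprVn sqrtCK.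
  by rewrite bra_ket_unnormalized.
have -> : bra_ket (color_code_state R G)
    (tensor (fun a => vertex_op beta (J a)) *m color_code_state R G) =
    ((4 * 2 ^ #|face G|)%:R)^-1 * bra_ket (unnormalized_color_code R G)
      (tensor (fun a => vertex_op beta (J a)) *m unnormalized_color_code R G).
  rewrite /bra_ket /color_code_state -/n -!scalemxAr [(_ *: _)^T]linearZ /=.
  by rewrite map_mxZ -scalemxAl scalerA mxE [n^-1 * _]mulrC n2.
rewrite bra_ket_tensor_unnormalized // -(rmorph_nat (real_complex R)) -fmorphV.
rewrite -!rmorphM; congr (_%:C).
set D := \prod_a _; have D0 : D != 0.
  apply/prodf_neq0 => a _; rewrite gt_eqF // sqrtr_gt0.
  by rewrite addr_gt0 // expR_gt0.
have two0 : (2 : R) != 0 by rewrite pnatr_eq0.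
(* The two powers of 2 have ratio 16, whose root 4 cancels the kernel size in the squared norm. *)
have -> : gamma beta J / Num.sqrt (2 ^ (#|face G|%:Z - 2)) = 4 * D.
  rewrite /gamma -/D mulrAC; congr (_ * _).
  rewrite -sqrtrV ?exprz_ge0 // -sqrtrM ?exprn_ge0 //.
  rewrite (_ : 2 ^+ _ = 4 ^+ 2 * 2 ^ (#|face G|%:Z - 2)); last first.
    rewrite (_ : 4 ^+ 2 = 2 ^+ 4); last by rewrite -!natrX.
    rewrite !exprnP -expfzDr //.
    by congr (_ ^ _); rewrite addrCA PoszD.
  by rewrite mulfK ?expfz_neq0 // sqrtr_sqr ger0_norm.
rewrite -[partition_function _ _ *+ _]mulr_natr.
have N0 : (2 ^ #|face G|)%:R != 0 :> R by rewrite pnatr_eq0 expn_eq0.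
rewrite natrM; move: (partition_function beta J) D (2 ^ _)%:R D0 N0.
by move=> P D N D0 N0; field; rewrite N0 D0.
Qed.
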